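(* Let $M$ be a finitely generated multigraded $S$-module with a multigraded free resolution $$\mathbb{F}:\ 0\to F_p \xrightarrow{\varphi_p} F_{p-1}\to \cdots \to F_1 \xrightarrow{\varphi_1} F_0\to 0.$$ Then $$\mathbb{F}^*:\ 0\to F_p^*\xrightarrow{\varphi_p^*} F_{p-1}^*\to \cdots \to F_1^*\xrightarrow{\varphi_1^*} F_0^*\to 0$$ is an acyclic sequence of multigraded $S^*$-modules (i.e. a complex with $H_i(\mathbb{F}^* )=0$ for all $i>0$) with $H_0(\mathbb{F}^* )\cong M^*$.
   Context: Let $K$ be a field and $S=K[x_1,\ldots,x_n]$. Fix an $n$-tuple $(i_1,\ldots,i_n)$ of positive integers, let $S^*$ be the polynomial ring over $K$ in the variables $x_{jk}$, $1\le j\le n$, $1\le k\le i_j$, and set $P_j=(x_{j1},\ldots,x_{ji_j})\subseteq S^*$. For $\mathbf{a}=(a(1),\ldots,a(n))\in\mathbb{N}^n$ put $(\mathbf{x}^{\mathbf{a}})^*=P_1^{a(1)}\cdots P_n^{a(n)}\subseteq S^*$. Polynomial rings carry the standard multigrading (by exponent vectors of monomials). Multigraded $S$-modules are understood to be $\mathbb{N}^n$-graded, so all shifts of multigraded free modules lie in $\mathbb{N}^n$; free modules are finitely generated. For $F=\bigoplus_i S(-\mathbf{a}_i)$ put $F^*=\bigoplus_i(\mathbf{x}^{\mathbf{a}_i})^*$. A multigraded homomorphism $\alpha:\bigoplus_{i=1}^r S(-\mathbf{a}_i)\to\bigoplus_{j=1}^s S(-\mathbf{b}_j)$ has components $S(-\mathbf{a}_i)\to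 S(-\mathbf{b}_j)$, $f\mapsto \lambda_{ji}\mathbf{x}^{\mathbf{a}_i-\mathbf{b}_j}f$, with $\lambda_{ji}\in K$ and $\lambda_{ji}=0$ if $\mathbf{x}^{\mathbf{b}_j}\nmid\mathbf{x}^{\mathbf{a}_i}$. Define $\alpha^*:\bigoplus_i(\mathbf{x}^{\mathbf{a}_i})^*\to\bigoplus_j(\mathbf{x}^{\mathbf{b}_j})^*$ as the map with components $f\mapsto\lambda_{ji}f$ if $\mathbf{x}^{\mathbf{b}_j}\mid\mathbf{x}^{\mathbf{a}_i}$ (note that then $(\mathbf{x}^{\mathbf{a}_i})^*\subseteq(\mathbf{x}^{\mathbf{b}_j})^*$), and zero otherwise. For a finitely generated multigraded $S$-module $M$, one chooses a multigraded free presentation $F_1\xrightarrow{\varphi}F_0\to M\to0$ and sets $M^*=\operatorname{Coker}\varphi^*$. *)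

(* Defs.v *)
From HB Require Import structures.
From mathcomp Require Import all_boot all_order all_algebra.
From mathcomp Require Import generic_quotient ring_quotient.
From mathcomp Require Import boolp.
From mathcomp Require Export mpoly.

Set Implicit Arguments.
Unset Strict Implicit.
Unset Printing Implicit Defensive.

Import GRing.Theory.
Local Open Scope ring_scope.
Local Open Scope quotient_scope.

Section Submodules.
Context (R : nzRingType) (M : lmodType R) (U : submodClosed M).

Definition submod := {u : M | u \in U}.
HB.instance Definition _ := Choice.on submod.
HB.instance Definition _ := SubType.on submod.
HB.instance Definition _ := [SubChoice_isSubLmodule of submod by <:].

Fact submod_zmod_closed : zmod_closed (U : {pred M}).
Proof. by split=> [|u v Uu Uv]; rewrite ?rpred0 // -scaleN1r rpredD ?rpredZ. Qed.

Definition submod_zmod : zmodClosed M :=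
  HB.pack_for (zmodClosed M) (GRing.SubmodClosed.sort U)
    (GRing.isZmodClosed.Build M (GRing.SubmodClosed.sort U) submod_zmod_closed).

Definition quotmod := Quotient.quot submod_zmod.
HB.instance Definition _ := GRing.Zmodule.on quotmod.

Definition quot_proj (u : M) : quotmod := \pi_quotmod u.

Fact quot_projP u v : quot_proj u = quot_proj v <-> u - v \in U.
Proof.
have -> : (u - v \in U) = (u - v \in submod_zmod) by [].
by rewrite Quotient.idealrBE; split=> /eqP.
Qed.

Fact quot_proj_zmod_morphism : zmod_morphism quot_proj.
Proof. by move=> u v; rewrite /quot_proj [LHS]raddfB. Qed.

Definition quot_scale (a : R) (x : quotmod) : quotmod := quot_proj (a *: repr x).

Fact quot_scaleE a u : quot_scale a (quot_proj u) = quot_proj (a *: u).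
Proof.
apply/quot_projP; rewrite -scalerBr rpredZ //.
by apply/quot_projP; rewrite /quot_proj reprK.
Qed.

Fact quot_projK (x : quotmod) : quot_proj (repr x) = x.
Proof. by rewrite /quot_proj reprK. Qed.

Fact quot_projD u v : quot_proj (u + v) = quot_proj u + quot_proj v.
Proof.
have N w : quot_proj (- w) = - quot_proj w.
  have := quot_proj_zmod_morphism 0 w; rewrite sub0r => ->.
  by have := quot_proj_zmod_morphism 0 0; rewrite !subrr => ->; rewrite sub0r.
by rewrite -[v in LHS]opprK quot_proj_zmod_morphism N opprK.
Qed.

Fact quot_scalerA a b x : quot_scale a (quot_scale b x) = quot_scale (a * b) x.
Proof. by rewrite -(quot_projK x) !quot_scaleE scalerA. Qed.
Fact quot_scale1r : left_id 1 quot_scale.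
Proof. by move=> x; rewrite -(quot_projK x) quot_scaleE scale1r. Qed.
Fact quot_scalerDr : right_distributive quot_scale +%R.
Proof.
move=> a x y; rewrite -(quot_projK x) -(quot_projK y) -quot_projD !quot_scaleE.
by rewrite scalerDr quot_projD.
Qed.
Fact quot_scalerDl x : {morph quot_scale^~ x : a b / a + b}.
Proof. by move=> a b; rewrite -(quot_projK x) !quot_scaleE scalerDl quot_projD. Qed.

HB.instance Definition _ := GRing.Zmodule_isLmodule.Build R quotmod
  quot_scalerA quot_scale1r quot_scalerDr quot_scalerDl.

Fact quot_proj_linear : linear quot_proj.
Proof. by move=> a u v; rewrite quot_projD -quot_scaleE. Qed.
HB.instance Definition _ := GRing.isLinear.Build R M quotmod _ quot_proj
  quot_proj_linear.

End Submodules.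

Section KernelImage.
Context (R : nzRingType) (M N : lmodType R) (f : {linear M -> N}).

Definition lkernel : pred M := fun u => f u == 0.
Definition limage : pred N := fun v => `[< exists u, f u = v >].

Fact lkernel_closed : submod_closed lkernel.
Proof.
split=> [|a u v]; rewrite !unfold_in ?linear0 // => /eqP fu /eqP fv.
by rewrite linearP fu fv scaler0 addr0.
Qed.
HB.instance Definition _ := GRing.isSubmodClosed.Build R M lkernel lkernel_closed.
Definition lkernel_submod : submodClosed M := GRing.SubmodClosed.clone _ M lkernel _.

Fact limage_closed : submod_closed limage.
Proof.
split=> [|a u v]; rewrite !unfold_in; first by apply/asboolP; exists 0; rewrite linear0.
move=> /asboolP[x <-] /asboolP[y <-]; apply/asboolP; exists (a *: x + y).
by rewrite linearP.
Qed.
HB.instance Definition _ := GRing.isSubmodClosed.Build R N limage limage_closed.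
Definition limage_submod : submodClosed N := GRing.SubmodClosed.clone _ N limage _.

Definition coker : lmodType R := quotmod limage_submod.
End KernelImage.

Section Homology.
Context (R : nzRingType).

Section Middle.
Context (A B C : lmodType R) (f : {linear A -> B}) (g : {linear B -> C}).

Definition boundaries : pred (submod (lkernel_submod g)) := fun z => val z \in limage f.

Fact boundaries_closed : submod_closed boundaries.
Proof.
have [im0 imP] := limage_closed f.
by split=> [|a u v Bu Bv]; [exact: im0 | exact: imP].
Qed.
HB.instance Definition _ :=
  GRing.isSubmodClosed.Build R (submod (lkernel_submod g)) boundaries boundaries_closed.
Definition boundaries_submod : submodClosed (submod (lkernel_submod g)) :=
  GRing.SubmodClosed.clone _ (submod (lkernel_submod g)) boundaries _.
End Middle.

Context (C : nat -> lmodType R) (d : forall i, {linear C i.+1 -> C i}).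

Definition is_complex := forall i (u : C i.+2), d i (d i.+1 u) = 0.

(* The chain complex is  ... -> C 1 -> C 0 -> 0, so the cycles in degree 0 are
   all of C 0. *)
Definition homology (i : nat) : lmodType R :=
  match i with
  | 0%N => coker (d 0)
  | i'.+1 => quotmod (boundaries_submod (d i'.+1) (d i'))
  end.

Definition acyclic := is_complex /\ forall i (h : homology i.+1), h = 0.
End Homology.

Definition finitely_generated (R : nzRingType) (M : lmodType R) :=
  exists s : seq M, forall u, exists c : 'I_(size s) -> R,
    u = \sum_(i < size s) c i *: s`_i.

Section Multigraded.
Context (K : fieldType) (n : nat).
Local Notation S := {mpoly K[n]}.

Record is_multigrading (M : lmodType S) (M_ : 'X_{1..n} -> M -> Prop) : Prop := {
  mg_zero : forall a, M_ a 0;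
  mg_add : forall a u v, M_ a u -> M_ a v -> M_ a (u + v);
  mg_scale : forall a b (c : K) u, M_ a u -> M_ (b + a)%MM ((c *: 'X_[b] : S) *: u);
  mg_sum : forall u, exists (s : seq 'X_{1..n}) (w : 'X_{1..n} -> M),
    (forall a, M_ a (w a)) /\ u = \sum_(a <- s) w a;
  mg_direct : forall (s : seq 'X_{1..n}) (w : 'X_{1..n} -> M), uniq s ->
    (forall a, M_ a (w a)) -> \sum_(a <- s) w a = 0 -> forall a, a \in s -> w a = 0
}.

Definition is_graded (M N : lmodType S) (M_ : 'X_{1..n} -> M -> Prop)
    (N_ : 'X_{1..n} -> N -> Prop) (f : {linear M -> N}) :=
  forall a u, M_ a u -> N_ a (f u).

Definition graded_isomorphic (M N : lmodType S) (M_ : 'X_{1..n} -> M -> Prop)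
    (N_ : 'X_{1..n} -> N -> Prop) :=
  exists f : {linear M -> N}, bijective f /\ forall a u, M_ a u <-> N_ a (f u).

Definition coker_comp (M N : lmodType S) (f : {linear M -> N})
    (N_ : 'X_{1..n} -> N -> Prop) (a : 'X_{1..n}) (x : coker f) : Prop :=
  exists2 v, N_ a v & quot_proj (limage_submod f) v = x.

End Multigraded.
Arguments coker_comp {K n M N} f N_ a x.

(* The free module  S(-a_1) (+) ... (+) S(-a_r). *)
Record mfree (n : nat) := MFree { rk : nat; shift : 'I_rk -> 'X_{1..n} }.

Section Free.
Context (K : fieldType) (n : nat).

Definition fmod (F : mfree n) : lmodType {mpoly K[n]} := 'cV[{mpoly K[n]}]_(rk F).

(* A polynomial f is in the component S(-a)_c = S_(c - a) iff every monomial x^m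
   of its support satisfies m + a = c. *)
Definition fmod_comp (F : mfree n) (c : 'X_{1..n}) (v : fmod F) : Prop :=
  forall (i : 'I_(rk F)) (m : 'X_{1..n}),
    m \in msupp (v i 0) -> (m + shift i)%MM = c.

Definition is_presentation (M : lmodType {mpoly K[n]})
    (M_ : 'X_{1..n} -> M -> Prop) (F1 F0 : mfree n)
    (phi : {linear fmod F1 -> fmod F0}) (eps : {linear fmod F0 -> M}) : Prop :=
  [/\ is_graded (@fmod_comp F1) (@fmod_comp F0) phi,
      is_graded (@fmod_comp F0) M_ eps,
      forall x, exists u, eps u = x
    & lkernel eps =i limage phi].

(* F 0, ..., F p are the modules of the resolution; F i = 0 for i > p, and
   [phi i] is the differential F (i + 1) -> F i. *)
Definition is_free_resolution (M : lmodType {mpoly K[n]})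
    (M_ : 'X_{1..n} -> M -> Prop) (p : nat) (F : nat -> mfree n)
    (phi : forall i, {linear fmod (F i.+1) -> fmod (F i)})
    (eps : {linear fmod (F 0) -> M}) : Prop :=
  [/\ forall i, (p < i)%N -> rk (F i) = 0%N,
      forall i, is_graded (@fmod_comp (F i.+1)) (@fmod_comp (F i)) (phi i),
      acyclic phi
    & is_presentation M_ (phi 0) eps].

(* The scalar lambda_ji of the component S(-a_i) -> S(-b_j), f |->
   lambda_ji x^(a_i - b_j) f, is read off the image of the i-th basis vector. *)
Definition mcoef (F G : mfree n) (phi : {linear fmod F -> fmod G})
    (j : 'I_(rk G)) (i : 'I_(rk F)) : K :=
  if (shift j <= shift i)%MM
  then (phi (delta_mx i 0 : 'cV__) j 0)@_(shift i - shift j) else 0.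

Fact mcoefP (F G : mfree n) (phi : {linear fmod F -> fmod G}) :
  is_graded (@fmod_comp F) (@fmod_comp G) phi ->
  forall v j, phi v j 0 =
    \sum_i (mcoef phi j i *: 'X_[shift i - shift j]) * v i 0.
Proof.
move=> gphi v j.
have col (i : 'I_(rk F)) : phi (delta_mx i 0 : 'cV__) j 0 =
    mcoef phi j i *: 'X_[shift i - shift j].
  have sub m : m \in msupp (phi (delta_mx i 0 : 'cV__) j 0) ->
      (m + shift j)%MM = shift i.
    apply: gphi => k m'; rewrite !mxE eqxx andbT.
    case: eqP => [->|_]; last by rewrite msupp0.
    by rewrite msupp1 inE => /eqP ->; rewrite add0m.
  rewrite /mcoef; case: ifP => [le|nle]; last first.
    rewrite scale0r; apply/mpolyP => m; rewrite mcoeff0.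
    apply: memN_msupp_eq0; apply/negP => /sub eq.
    by move: nle; rewrite -eq lem_addl.
  apply/mpolyP => m; rewrite mcoeffZ mcoeffX.
  case: eqP => [<-|ne]; first by rewrite mulr1.
  rewrite mulr0; apply: memN_msupp_eq0; apply/negP => /sub eq.
  by apply: ne; rewrite -eq addmK.
have -> : v = \sum_i v i 0 *: (delta_mx i 0 : fmod F).
  apply/matrixP => k l; rewrite (ord1 l) summxE (bigD1 k) //= big1 => [|i ne].
    by rewrite addr0 !mxE !eqxx mulr1.
  by rewrite !mxE eq_sym (negPf ne) mulr0.
rewrite linear_sum summxE; apply: eq_bigr => i _.
rewrite linearZ mxE col mulrC; congr (_ * _).
rewrite summxE (bigD1 i) //= big1 => [|k ne]; first by rewrite addr0 !mxE !eqxx mulr1.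
by rewrite !mxE eq_sym (negPf ne) mulr0.
Qed.

End Free.

Section Ideals.
Context (R : comNzRingType).
Implicit Types I J : R -> Prop.

Definition ideal_span (X : R -> Prop) : R -> Prop := fun f =>
  exists s : seq (R * R), (forall p, p \in s -> X p.2) /\ f = \sum_(p <- s) p.1 * p.2.

Definition ideal_mul I J : R -> Prop :=
  ideal_span (fun h => exists f g, [/\ I f, J g & h = f * g]).

Definition ideal_full : R -> Prop := fun=> True.

Definition ideal_exp I (k : nat) : R -> Prop := iter k (ideal_mul I) ideal_full.

Definition is_ideal I :=
  I 0 /\ forall a f g, I f -> I g -> I (a * f + g).

Fact ideal_span_ideal X : is_ideal (ideal_span X).
Proof.
split=> [|a f g [s [Xs ->]] [t [Xt ->]]].
  by exists [::]; rewrite big_nil; split.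
exists ([seq (a * p.1, p.2) | p <- s] ++ t); split=> [p|].
  by rewrite mem_cat => /orP[/mapP[q /Xs ? ->]|/Xt].
rewrite big_cat big_map mulr_sumr /=; congr (_ + _).
by apply: eq_bigr => p _; rewrite mulrA.
Qed.

Fact ideal_span_mono X Y : (forall f, X f -> Y f) ->
  forall f, ideal_span X f -> ideal_span Y f.
Proof. by move=> XY f [s [Xs ->]]; exists s; split=> // p /Xs /XY. Qed.

Fact ideal_full_ideal : is_ideal ideal_full. Proof. by []. Qed.

Fact ideal_mul_mono I I' J J' : (forall f, I f -> I' f) -> (forall f, J f -> J' f) ->
  forall f, ideal_mul I J f -> ideal_mul I' J' f.
Proof.
move=> II' JJ'; apply: ideal_span_mono => h [f [g [/II' If /JJ' Jg ->]]].
by exists f, g.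
Qed.

Fact ideal_mul_sub I J f : is_ideal J -> ideal_mul I J f -> J f.
Proof.
move=> [J0 JP] [s [Xs ->]]; elim: s Xs => [|p s IH] Xs; first by rewrite big_nil.
rewrite big_cons; apply: (JP); last by apply: IH => q qs; apply: Xs; rewrite inE qs orbT.
have [g [h [_ Jh ->]]] := Xs p (mem_head p s).
by rewrite -[_ * h]addr0; apply: JP.
Qed.

Fact ideal_exp_ideal I k : is_ideal (ideal_exp I k).
Proof. by case: k => [|k]; [exact: ideal_full_ideal | exact: ideal_span_ideal]. Qed.

Fact ideal_exp_anti I k l f : (k <= l)%N -> ideal_exp I l f -> ideal_exp I k f.
Proof.
move=> /subnK <-; elim: (l - k)%N f => [//|m IH] f /ideal_mul_sub If.
by apply/IH/If/ideal_exp_ideal.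
Qed.

End Ideals.

(* [e j] is the number of variables x_jk replacing the variable x_j; both j and k
   are counted from 0. *)
Section Expansion.
Context (K : fieldType) (n : nat) (e : 'I_n -> nat).

Definition nvars : nat := #|{: {j : 'I_n & 'I_(e j)}}|.
Local Notation S := {mpoly K[n]}.
Local Notation S' := {mpoly K[nvars]}.

Definition xvar (j : 'I_n) (k : 'I_(e j)) : S' :=
  'X_(enum_rank (Tagged (fun j => 'I_(e j)) k)).

Definition prime_block (j : 'I_n) : S' -> Prop :=
  ideal_span (fun f => exists k : 'I_(e j), f = xvar k).

Definition expand_mon (a : 'X_{1..n}) : S' -> Prop :=
  \big[@ideal_mul S' / @ideal_full S']_(j < n) ideal_exp (prime_block j) (a j).

Fact expand_mon_ideal a : is_ideal (expand_mon a).
Proof.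
rewrite /expand_mon; elim/big_ind: _ => [|I J _ _|j _].
- exact: ideal_full_ideal.
- exact: ideal_span_ideal.
- exact: ideal_exp_ideal.
Qed.

Fact expand_mon_anti a b f : (b <= a)%MM -> expand_mon a f -> expand_mon b f.
Proof.
move=> /mnm_lepP ba; rewrite /expand_mon.
elim/big_ind2: _ f => [//|I I' J J' II' JJ' f|j _ f].
  exact: ideal_mul_mono.
exact: ideal_exp_anti.
Qed.

Section StarModule.
Context (F : mfree n).

Definition star_pred : pred ('cV[S']_(rk F)) :=
  fun v => `[< forall i, expand_mon (shift i) (v i 0) >].

Fact star_pred_closed : submod_closed star_pred.
Proof.
split=> [|a u v]; rewrite !unfold_in.
  by apply/asboolP => i; rewrite mxE; have [] := expand_mon_ideal (shift i).
move=> /asboolP su /asboolP sv; apply/asboolP => i; rewrite !mxE.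
by have [_] := expand_mon_ideal (shift i); apply.
Qed.
HB.instance Definition _ :=
  GRing.isSubmodClosed.Build S' 'cV[S']_(rk F) star_pred star_pred_closed.
Definition star_submod : submodClosed 'cV[S']_(rk F) :=
  GRing.SubmodClosed.clone _ 'cV[S']_(rk F) star_pred _.

Definition star : lmodType S' := submod star_submod.

Definition star_comp (c : 'X_{1..nvars}) (v : star) : Prop :=
  forall (i : 'I_(rk F)) (m : 'X_{1..nvars}), m \in msupp (val v i 0) -> m = c.

Fact starP (v : star) i : expand_mon (shift i) (val v i 0).
Proof. by case: v => v /= /asboolP. Qed.

End StarModule.

Section StarMap.
Context (F G : mfree n) (phi : {linear fmod K F -> fmod K G}).

(* [mcoef phi j i] is zero unless x^(b_j) divides x^(a_i). *)
Definition star_col (v : star F) : 'cV[S']_(rk G) :=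
  \col_j \sum_i mcoef phi j i *: val v i 0.

Fact star_col_mem v : star_col v \in star_submod G.
Proof.
apply/asboolP => j; rewrite mxE; have [e0 eP] := expand_mon_ideal (shift j).
elim/big_ind: _ => [//|f g If Ig|i _]; first by rewrite -[f]mul1r; apply: eP.
rewrite /mcoef; case: ifP => [ba|_]; last by rewrite scale0r.
rewrite -mul_mpolyC -[_ * _]addr0; apply: eP => //.
exact: (expand_mon_anti ba (starP v i)).
Qed.

Definition star_fun (v : star F) : star G := exist _ (star_col v) (star_col_mem v).

Fact star_fun_linear : linear star_fun.
Proof.
move=> a u v; apply: val_inj; rewrite linearP /=; apply/matrixP => j k.
rewrite !mxE mulr_sumr -big_split /=; apply: eq_bigr => i _.
by rewrite !mxE scalerDr scalerAr.
Qed.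
HB.instance Definition _ :=
  GRing.isLinear.Build S' (star F) (star G) _ star_fun star_fun_linear.
Definition star_map : {linear star F -> star G} := star_fun.
End StarMap.

(* M^*, computed from the presentation  psi : G1 -> G0  of M. *)
Definition star_coker (G1 G0 : mfree n) (psi : {linear fmod K G1 -> fmod K G0}) :
  lmodType S' := coker (star_map psi).

Definition star_coker_comp (G1 G0 : mfree n) (psi : {linear fmod K G1 -> fmod K G0}) :
    'X_{1..nvars} -> star_coker psi -> Prop :=
  coker_comp (star_map psi) (@star_comp G0).

End Expansion.
Arguments star_coker_comp {K n} e {G1 G0} psi a x.

(* Main.v *)
Require Import Defs.
From mathcomp Require Import all_boot all_algebra.
From HB Require Import structures.
From mathcomp Require Import boolp.

Set Implicit Arguments.
Unset Strict Implicit.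
Unset Printing Implicit Defensive.

Import GRing.Theory.
Local Open Scope ring_scope.

(* For an exponent c of S^*, let mbar c be the exponent of S with j-th entry
   sum_k c_jk. The ideal (x^a)^* is spanned by the monomials x^c with
   a <= mbar c, so the degree c part of F^* is the degree (mbar c) part of F, and
   under this identification phi^* is phi. Hence exactness passes from F to F^*
   degree by degree. For H_0, graded lifts F_0 -> G_0 and G_0 -> F_0 of the
   identity of M induce mutually inverse maps between the cokernels, which can
   again be tested degree by degree against the augmentations to M. *)

(** * Sums with one nonzero term; exponents, coefficients and supports of polynomials *)

Lemma sum_seq_pred1 (V : nmodType) (I : eqType) (s : seq I) (a : I) (x : V) :
  uniq s -> \sum_(i <- s) (if i == a then x else 0) = if a \in s then x else 0.
Proof.
move=> us; case: ifP => [as_|/negbT nas]; last first.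
  rewrite big_seq big1 // => i is_; case: eqP => // e.
  by rewrite -e is_ in nas.
rewrite (bigD1_seq a) //= eqxx big1 ?addr0 // => i ne.
by rewrite (negPf ne).
Qed.

Section Coefficients.
Context (R : comNzRingType) (n : nat).
Implicit Types (p : {mpoly R[n]}) (m d : 'X_{1..n}).

(** Subtraction of exponents is truncated entrywise; the divisibility hypotheses make it exact. *)
Lemma submDB m d a : (a <= d)%MM -> (d <= m)%MM -> (m - d + (d - a) = m - a)%MM.
Proof.
move=> /mnm_lepP ad /mnm_lepP dm; apply/mnmP => i; rewrite !mnmE.
by rewrite addnBA // subnK.
Qed.

Lemma submBB m d a : (a <= d)%MM -> (m - a - (d - a) = m - d)%MM.
Proof.
by move=> /mnm_lepP ad; apply/mnmP => i; rewrite !mnmE -subnDA subnKC.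
Qed.

Lemma lepm_sub2r m d a : (a <= d)%MM -> (a <= m)%MM ->
  (d - a <= m - a)%MM = (d <= m)%MM.
Proof.
move=> /mnm_lepP ad /mnm_lepP am; apply/mnm_lepP/mnm_lepP => le i.
  by have := le i; rewrite !mnmE leq_subLR subnKC ?am.
by rewrite !mnmE leq_sub2r ?le.
Qed.

Lemma mcoeffXM p d m :
  ('X_[d] * p)@_m = if (d <= m)%MM then p@_(m - d) else 0.
Proof.
rewrite mulrC; case: ifP => [le|nle]; first by rewrite -{1}(submK le) addmC mcoeffMX.
apply: memN_msupp_eq0; apply/negP.
by rewrite (perm_mem (msuppMX _ _)) => /mapP[k _ e]; rewrite e lem_addr in nle.
Qed.

Lemma msuppZX a d m : m \in msupp (a *: 'X_[d] : {mpoly R[n]}) -> m = d.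
Proof. by move=> /msuppZ_le; rewrite msuppX inE => /eqP. Qed.

Lemma mem_msupp_sum (I : eqType) (r : seq I) (P : pred I) (f : I -> {mpoly R[n]}) m :
  m \in msupp (\sum_(i <- r | P i) f i) -> exists2 i, i \in r & m \in msupp (f i).
Proof.
move=> /(msupp_sum_le (P := P)) /flattenP[_ /mapP[i + ->]].
by rewrite mem_filter => /andP[_ ir]; exists i.
Qed.

End Coefficients.

(** * The ideals (x^a)^* described by their monomials *)

Section MonomialIdeals.
Context (K : fieldType) (n : nat) (e : 'I_n -> nat).
Local Notation S' := {mpoly K[nvars e]}.
Implicit Types (a : 'X_{1..n}) (c : 'X_{1..nvars e}) (j : 'I_n).

Definition vidx j (k : 'I_(e j)) : 'I_(nvars e) :=
  enum_rank (Tagged (fun j => 'I_(e j)) k).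

(* The degree of the monomial x^c when all the x_jk are replaced by x_j. *)
Definition mbar c : 'X_{1..n} := [multinom \sum_(k < e j) c (vidx k) | j < n].

(** The part of [c] in the variables of block [j]. Splitting x^c into these parts matches the
    factorization P_1^a(1) ... P_n^a(n). *)
Definition mblock j c : 'X_{1..nvars e} :=
  [multinom if tag (enum_val i) == j then c i else 0%N | i < nvars e].

Lemma mbarE c j : mbar c j = (\sum_(k < e j) c (vidx k))%N.
Proof. by rewrite mnmE. Qed.

Lemma mbarD c d : mbar (c + d)%MM = (mbar c + mbar d)%MM.
Proof.
apply/mnmP => j; rewrite mnmDE !mbarE -big_split; apply: eq_bigr => k _.
by rewrite mnmDE.
Qed.

Lemma mbar_block c j : mbar (mblock j c) j = mbar c j.
Proof.
by rewrite !mbarE; apply: eq_bigr => k _; rewrite mnmE /vidx enum_rankK eqxx.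
Qed.

Lemma sum_mblock c : (\sum_j mblock j c)%MM = c.
Proof.
apply/mnmP => i; rewrite mnm_sumE (bigD1 (tag (enum_val i))) //= big1 => [|j ne].
  by rewrite mnmE eqxx addn0.
by rewrite mnmE eq_sym (negPf ne).
Qed.

Lemma mbar1 j (k : 'I_(e j)) : mbar U_(vidx k) j = 1%N.
Proof.
rewrite mbarE (bigD1 k) //= big1 ?mnm1E ?eqxx ?addn0 // => k' ne.
rewrite mnm1E; case: eqP => // /enum_rank_inj /eqP.
by rewrite eq_Tagged /= eq_sym (negPf ne).
Qed.

Lemma ideal_mull (R : comNzRingType) (I : R -> Prop) f g :
  is_ideal I -> I g -> I (f * g).
Proof. by move=> [I0 IP] Ig; rewrite -[_ * _]addr0; apply: IP. Qed.

Lemma ideal_mul_mem (R : comNzRingType) (I J : R -> Prop) f g :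
  I f -> J g -> ideal_mul I J (f * g).
Proof.
move=> If Jg; exists [:: (1, f * g)]; rewrite big_seq1 mul1r; split=> // q.
by rewrite inE => /eqP ->; exists f, g.
Qed.

Lemma ideal_mul_subl (R : comNzRingType) (I J : R -> Prop) f :
  is_ideal I -> ideal_mul I J f -> I f.
Proof.
move=> iI [s [Xs ->]]; rewrite big_seq.
have [I0 IP] := iI; elim/big_ind: _ => // [g h Ig Ih|q /Xs[g [h [Ig _ ->]]]].
  by rewrite -[g]mul1r; apply: IP.
by rewrite [g * h]mulrC mulrA; apply: ideal_mull.
Qed.

Lemma prime_block_supp j f c : prime_block (K := K) j f -> c \in msupp f ->
  (0 < mbar c j)%N.
Proof.
case=> s [Xs ->] /mem_msupp_sum[q /Xs[k ->]] /msuppM_le /allpairsP[[m1 m2] /= [_ + ->]].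
rewrite msuppX inE => /eqP ->.
by rewrite mbarD mnmDE mbar1 addn1.
Qed.

(** Each factor from P_j puts some x_jk into every monomial, and [mbar] is additive. *)
Lemma ideal_exp_supp j k f c : ideal_exp (prime_block (K := K) j) k f ->
  c \in msupp f -> (k <= mbar c j)%N.
Proof.
elim: k f c => [//|k IH] f c; case=> s [Xs ->] /mem_msupp_sum[q /Xs[g [h [Pg Ph ->]]]].
move=> /msuppM_le /allpairsP[[m m'] /= [_ /msuppM_le + ->]].
move=> /allpairsP[[m1 m2] /= [/(prime_block_supp Pg) lt1 /(IH _ _ Ph) le2 ->]].
by rewrite !mbarD !mnmDE ltn_addl // -add1n leq_add.
Qed.

(** Induction on [k]: a positive j-th entry of [mbar c] means that some x_jk divides x^c, and this
    variable is split off. *)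
Lemma ideal_exp_X j k c : (k <= mbar c j)%N ->
  ideal_exp (prime_block (K := K) j) k 'X_[c].
Proof.
elim: k c => [//|k IH] c lt.
have [i ci] : exists i : 'I_(e j), (0 < c (vidx i))%N.
  apply/existsP; apply: contraTT lt.
  rewrite negb_exists => /forallP c0.
  by rewrite mbarE big1 // => i _; have := c0 i; case: (c _).
have le : (U_(vidx i) <= c)%MM.
  by apply/mnm_lepP => l; rewrite mnm1E; case: eqP => // <-.
rewrite -(submK le) addmC mpolyXD.
apply: ideal_mul_mem.
  exists [:: (1, 'X_(vidx i))]; rewrite big_seq1 mul1r; split=> // q.
  by rewrite inE => /eqP ->; exists i.
by apply: IH; move: lt; rewrite -{1}(submK le) mbarD mnmDE mbar1 addn1.
Qed.

(** A product of ideals is contained in each of its factors. *)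
Lemma expand_mon_exp a (f : S') j :
  expand_mon a f -> ideal_exp (@prime_block K n e j) (a j) f.
Proof.
rewrite /expand_mon; have := mem_index_enum j.
elim: (index_enum _) f => [//|i r IH] f; rewrite inE big_cons => /orP[/eqP ->|jr].
  by apply: ideal_mul_subl; apply: ideal_exp_ideal.
move=> /ideal_mul_sub If; apply: IH => //; apply: If.
elim/big_ind: _ => [|I J _ _|l _]; first exact: ideal_full_ideal.
  exact: ideal_span_ideal.
exact: ideal_exp_ideal.
Qed.

Lemma expand_monP a (f : S') :
  expand_mon a f <-> forall c, c \in msupp f -> (a <= mbar c)%MM.
Proof.
split=> [If c cf|le].
  by apply/mnm_lepP => j; apply: ideal_exp_supp cf; apply: expand_mon_exp.
rewrite [f]mpolyE big_seq.
have [I0 IP] := expand_mon_ideal K e a; elim/big_ind: _ => // [g h Ig Ih|c cf].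
  by rewrite -[g]mul1r; apply: IP.
rewrite -mul_mpolyC; apply: ideal_mull; first exact: expand_mon_ideal.
(* It suffices to put x^c into (x^(mbar c))^*, where the block [j] of x^c lies in P_j to the power
   [mbar c j]. *)
apply: (expand_mon_anti (le c cf)).
rewrite -{2}(sum_mblock c) (big_morph _ (mpolyXD K) (mpolyX0 _ K)) /expand_mon.
elim/big_ind2: _ => // [x I y J|j _]; first exact: ideal_mul_mem.
by apply: ideal_exp_X; rewrite mbar_block.
Qed.

End MonomialIdeals.

(** * Vanishing of homology and isomorphisms of cokernels *)

Section Quotients.
Context (R : nzRingType).

Lemma quotmod_eq0 (N : lmodType R) (U : submodClosed N) (u : N) :
  quot_proj U u = 0 <-> u \in U.
Proof. by rewrite -(linear0 (quot_proj U)) quot_projP subr0. Qed.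

Lemma limageP (A B : lmodType R) (f : {linear A -> B}) v :
  v \in limage f <-> exists u, f u = v.
Proof. by split=> [/asboolP|?] //; apply/asboolP. Qed.

(** Replaces the quotient by a condition on elements, which can be tested degree by degree. *)
Lemma homology_eq0 (A B C : lmodType R) (f : {linear A -> B}) (g : {linear B -> C}) :
  (forall h : quotmod (boundaries_submod f g), h = 0) <->
  (forall u, g u = 0 -> u \in limage f).
Proof.
split=> [h0 u /eqP gu|im h].
  by have /quotmod_eq0 := h0 (quot_proj (boundaries_submod f g) (exist _ u gu)).
rewrite -(quot_projK h); apply/quotmod_eq0.
by case: (generic_quotient.repr h) => u gu; apply: im; apply/eqP.
Qed.

(** As [a] preserves and reflects the images, the induced map is well defined and injective; the
    class of [b w] is a preimage of the class of [w]. *)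
Lemma coker_iso (A B A' B' : lmodType R) (f : {linear A -> B}) (g : {linear A' -> B'})
    (a : {linear B -> B'}) (b : {linear B' -> B}) :
  (forall v, (a v \in limage g) = (v \in limage f)) ->
  (forall w, a (b w) - w \in limage g) ->
  exists2 h : {linear coker f -> coker g}, bijective h &
    forall v, h (quot_proj (limage_submod f) v) = quot_proj (limage_submod g) (a v).
Proof.
move=> imE ab.
pose pf := quot_proj (limage_submod f); pose pg := quot_proj (limage_submod g).
pose h (x : coker f) : coker g := pg (a (generic_quotient.repr x)).
have hE v : h (pf v) = pg (a v).
  apply/quot_projP; rewrite -linearB; rewrite -[_ \in _]/(_ \in limage g) imE.
  by apply/(quot_projP (limage_submod f)); rewrite quot_projK.
have hlin : linear h.
  move=> c x y; rewrite -(quot_projK x) -(quot_projK y) -/pf.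
  have -> : c *: pf (generic_quotient.repr x) + pf (generic_quotient.repr y) =
      pf (c *: generic_quotient.repr x + generic_quotient.repr y).
    by rewrite /pf linearP.
  by rewrite !hE /pg !linearP.
pose hL : {linear coker f -> coker g} :=
  HB.pack_for {linear coker f -> coker g} h (GRing.isLinear.Build _ _ _ _ h hlin).
exists hL => //.
exists (fun y : coker g => pf (b (generic_quotient.repr y))) => x /=.
  rewrite -[RHS]quot_projK; apply/quot_projP; rewrite -[_ \in _]/(_ \in limage f).
  rewrite -imE linearB /=.
  set w := generic_quotient.repr (h x).
  have /(quot_projP (limage_submod g)) wP : pg w = h x by apply: quot_projK.
  (* The difference is split at [w]: one summand is in the image by [ab], the other because [w]
     represents [h x]. *)
  rewrite -(subrK w (a (b w))) -addrA.
  by apply: (rpredD (S := limage_submod g) (ab w) wP).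
rewrite [LHS]hE -[RHS]quot_projK; apply/quot_projP; exact: ab.
Qed.

End Quotients.

(** * Homogeneous components and graded lifts for free modules *)

Section FreeModules.
Context (K : fieldType) (n : nat).
Local Notation S := {mpoly K[n]}.

Lemma fmod_decomposition (F : mfree n) (u : fmod K F) :
  exists (s : seq 'X_{1..n}) (w : 'X_{1..n} -> fmod K F),
    [/\ uniq s, forall a, fmod_comp a (w a) & u = \sum_(a <- s) w a].
Proof.
(* In degree [a], the i-th entry keeps only its monomial of exponent [a - shift i]; the guard
   excludes truncated differences. *)
pose w a : fmod K F := \col_i if (shift i <= a)%MM
  then (u i 0)@_(a - shift i) *: 'X_[a - shift i] else 0.
pose s := undup (flatten [seq [seq (m + shift i)%MM | m <- msupp (u i 0)] |
  i <- enum 'I_(rk F)]).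
exists s, w; split=> [|a i m|]; first exact: undup_uniq.
  rewrite mxE; case: ifP => [le /msuppZX -> | _]; first exact: submK.
  by rewrite msupp0.
have us : uniq s by exact: undup_uniq.
apply/matrixP => i j; rewrite (ord1 j) summxE; apply/mpolyP => m.
have wE a : (w a i 0)@_m = if a == (m + shift i)%MM then (u i 0)@_m else 0.
  rewrite mxE; case: (eqVneq a (m + shift i)%MM) => [->|ne].
    by rewrite lem_addl addmK mcoeffZ mcoeffX eqxx mulr1.
  case: ifP => [le|_]; last by rewrite mcoeff0.
  rewrite mcoeffZ mcoeffX; case: eqP => [e|_]; last by rewrite mulr0.
  by rewrite -e submK ?eqxx in ne.
rewrite raddf_sum (eq_bigr _ (fun a _ => wE a)) sum_seq_pred1 //.
have [mu|mu] := boolP (m \in msupp (u i 0)); last first.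
  by rewrite (memN_msupp_eq0 mu) if_same.
have ms : (m + shift i)%MM \in s.
  rewrite mem_undup; apply/flattenP; exists [seq (m + shift i)%MM | m <- msupp (u i 0)].
    by apply/mapP; exists i; rewrite ?mem_enum.
  by apply/mapP; exists m.
by rewrite ms.
Qed.

Section Lift.
Context (M : lmodType S) (M_ : 'X_{1..n} -> M -> Prop).
Hypothesis M_graded : is_multigrading M_.

(** The degree [a] component of any preimage works, because the grading of [M] is direct. *)
Lemma homogeneous_preimage (G : mfree n) (eta : {linear fmod K G -> M}) a x :
  is_graded (@fmod_comp K n G) M_ eta -> (exists u, eta u = x) -> M_ a x ->
  exists2 u, fmod_comp a u & eta u = x.
Proof.
move=> geta [u <-{x}] Mx; have [s [w [us wc uE]]] := fmod_decomposition u.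
exists (if a \in s then w a else 0).
  by case: ifP => // _ i m; rewrite mxE msupp0.
(* The family [w'] consists of the images of the components of [u], with [eta u] subtracted in
   degree [a]. Adjoining [a] to the degrees makes its sum 0, so [w' a] vanishes. *)
pose t := if a \in s then s else a :: s.
pose w' b := eta (if b \in s then w b else 0) - (if b == a then eta u else 0).
have at_ : a \in t by rewrite /t; case: ifP => // _; rewrite mem_head.
have ut : uniq t by rewrite /t; case: ifP => //= ->.
have /(_ a at_) : forall b, b \in t -> w' b = 0.
  apply: (mg_direct M_graded ut) => [b|].
    rewrite /w'; apply: (mg_add M_graded).
      by apply: geta; case: ifP => // _ i m; rewrite mxE msupp0.
    case: eqP => [->|_]; last by rewrite oppr0; apply: mg_zero.
    (* Closure under opposites is scaling by the constant monomial -1, of degree 0. *)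
    have := mg_scale M_graded 0%MM (-1) Mx.
    by rewrite add0m mpolyX0 -linearZ /= scaleNr scale1r scaleN1r linearN.
  rewrite sumrB sum_seq_pred1 // at_.
  rewrite -linear_sum -big_mkcond /= -linearB.
  suff -> : \sum_(b <- t | b \in s) w b = u by rewrite subrr linear0.
  rewrite [RHS]uE -big_filter /t; case: ifP => as_ /=; last rewrite as_.
    by rewrite (all_filterP _) //; apply/allP.
  by rewrite (all_filterP _) //; apply/allP.
by rewrite /w' eqxx => /eqP; rewrite subr_eq0 => /eqP.
Qed.

(** Projectivity of free modules: homogeneous preimages are chosen for the images of the basis
    vectors and extended linearly. *)
Lemma graded_lift (F G : mfree n) (eps : {linear fmod K F -> M})
    (eta : {linear fmod K G -> M}) :
  is_graded (@fmod_comp K n F) M_ eps -> is_graded (@fmod_comp K n G) M_ eta ->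
  (forall x, exists u, eta u = x) ->
  exists2 alpha : {linear fmod K F -> fmod K G},
    is_graded (@fmod_comp K n F) (@fmod_comp K n G) alpha &
    forall v, eta (alpha v) = eps v.
Proof.
move=> geps geta sur.
have base i : exists u : fmod K G, fmod_comp (shift i) u /\
    eta u = eps (delta_mx i 0 : 'cV__).
  suff /(homogeneous_preimage geta (sur _))[u] :
      M_ (shift i) (eps (delta_mx i 0 : 'cV__)).
    by exists u.
  apply: geps => k m; rewrite !mxE eqxx andbT.
  case: eqP => [->|_]; last by rewrite msupp0.
  by rewrite msupp1 inE => /eqP ->; rewrite add0m.
have [U UP] := choice base.
pose al (v : fmod K F) : fmod K G := \sum_i v i 0 *: U i.
have allin : linear al.
  move=> c u v; rewrite /al scaler_sumr -big_split; apply: eq_bigr => i _.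
  by rewrite !mxE scalerDl scalerA.
pose alpha : {linear fmod K F -> fmod K G} :=
  HB.pack_for {linear fmod K F -> fmod K G} al (GRing.isLinear.Build _ _ _ _ al allin).
exists alpha => [c v vc j m|v].
  rewrite summxE => /mem_msupp_sum[i _]; rewrite mxE.
  move=> /msuppM_le /allpairsP[[m1 m2] /= [/vc <- /(proj1 (UP i)) <- ->]].
  by rewrite addmA.
rewrite /= /al linear_sum.
have {2}-> : v = \sum_i v i 0 *: (delta_mx i 0 : fmod K F).
  apply/matrixP => k l; rewrite (ord1 l) summxE (bigD1 k) //= big1 => [|i ne].
    by rewrite addr0 !mxE !eqxx mulr1.
  by rewrite !mxE eq_sym (negPf ne) mulr0.
rewrite [RHS]linear_sum; apply: eq_bigr => i _.
by rewrite !linearZ (proj2 (UP i)).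
Qed.

End Lift.
End FreeModules.

(** * Homogeneous components of F^* as components of F *)

Section Slices.
Context (K : fieldType) (n : nat) (e : 'I_n -> nat).
Local Notation S' := {mpoly K[nvars e]}.
Local Notation star F := (@star K n e F).
Implicit Types (c : 'X_{1..nvars e}).

Lemma star_supp (F : mfree n) (v : star F) i c :
  c \in msupp (val v i 0) -> (shift i <= mbar c)%MM.
Proof. by have /expand_monP := starP v i; apply. Qed.

Lemma star_coef_eq0 (F : mfree n) (v : star F) i c :
  ~~ (shift i <= mbar c)%MM -> (val v i 0)@_c = 0.
Proof. by move=> nle; apply: memN_msupp_eq0; apply: contra nle => /star_supp. Qed.

(* [slice c] identifies the degree c part of F^* with the degree (mbar c) part
   of F; [unslice c] is its inverse, extended by zero on the other degrees. *)
Definition slice (F : mfree n) c (v : star F) : fmod K F :=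
  \col_i ((val v i 0)@_c *: 'X_[mbar c - shift i]).

Definition unslice_col (F : mfree n) c (w : fmod K F) : 'cV[S']_(rk F) :=
  \col_i (if (shift i <= mbar c)%MM then (w i 0)@_(mbar c - shift i) *: 'X_[c] else 0).

Lemma unslice_mem (F : mfree n) c (w : fmod K F) :
  unslice_col c w \in star_submod K e F.
Proof.
apply/asboolP => i; apply/expand_monP => m; rewrite mxE.
by case: ifP => [le /msuppZX -> //|_]; rewrite msupp0.
Qed.

Definition unslice (F : mfree n) c (w : fmod K F) : star F :=
  exist _ (unslice_col c w) (unslice_mem c w).

Lemma unslice_coef (F : mfree n) c (w : fmod K F) i m :
  (val (unslice c w) i 0)@_m = if m == c then
    (if (shift i <= mbar c)%MM then (w i 0)@_(mbar c - shift i) else 0) else 0.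
Proof.
rewrite /= mxE; case: ifP => _; last by rewrite mcoeff0 if_same.
rewrite mcoeffZ mcoeffX [m == c]eq_sym.
by case: (c == m); rewrite ?mulr1 ?mulr0.
Qed.

Lemma slice0 (F : mfree n) c : slice c (0 : star F) = 0.
Proof. by apply/matrixP => i j; rewrite !mxE mcoeff0 scale0r. Qed.

Lemma sliceB (F : mfree n) c (u v : star F) : slice c (u - v) = slice c u - slice c v.
Proof. by apply/matrixP => i j; rewrite !mxE mcoeffB scalerBl. Qed.

Lemma slice_inj (F : mfree n) (u v : star F) :
  (forall c, slice c u = slice c v) -> u = v.
Proof.
move=> uv; apply: val_inj; apply/matrixP => i j; rewrite (ord1 j).
apply/mpolyP => c; have /matrixP/(_ i 0) := uv c; rewrite !mxE.
(* Each entry of a slice is a scalar times a fixed monomial, whose coefficient gives the scalar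
   back. *)
by move=> /(congr1 (mcoeff (mbar c - shift i))); rewrite !mcoeffZ mcoeffX eqxx !mulr1.
Qed.

(** The composite is the projection onto degree [c]: where [unslice] puts 0 for lack of
    divisibility, the coefficient of [v] is already 0. *)
Lemma unslice_sliceE (F : mfree n) c (v : star F) i m :
  (val (unslice c (slice c v)) i 0)@_m = if m == c then (val v i 0)@_m else 0.
Proof.
rewrite unslice_coef; case: eqP => // ->; case: ifP => [le|/negbT nle].
  by rewrite mxE mcoeffZ mcoeffX eqxx mulr1.
by rewrite star_coef_eq0.
Qed.

Lemma star_decomposition (F : mfree n) (v : star F) :
  exists2 s, uniq s & v = \sum_(c <- s) unslice c (slice c v).
Proof.
pose s := undup (flatten [seq (msupp (val v i 0) : seq _) | i <- enum 'I_(rk F)]).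
have us : uniq s by exact: undup_uniq.
exists s => //; apply: val_inj; rewrite raddf_sum; apply/matrixP => i j.
rewrite (ord1 j) summxE; apply/mpolyP => m; rewrite raddf_sum.
rewrite (eq_bigr (fun c => if c == m then (val v i 0)@_m else 0)); last first.
  by move=> c _; rewrite [c == m]eq_sym; apply: unslice_sliceE.
rewrite sum_seq_pred1 //; case: ifP => // /negbT ms; apply: memN_msupp_eq0.
apply: contra ms => mi; rewrite mem_undup; apply/flattenP.
by exists (msupp (val v i 0)) => //; apply/mapP; exists i; rewrite ?mem_enum.
Qed.

Lemma unslice_comp (F : mfree n) c (w : fmod K F) : star_comp c (unslice c w).
Proof. by move=> i m; rewrite /= mxE; case: ifP => [_ /msuppZX|_]; rewrite ?msupp0. Qed.

Lemma star_multigrading (F : mfree n) : is_multigrading (@star_comp K n e F).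
Proof.
split=> [c i m|c u v uc vc i m|a c k u uc i m|v|s w us wc w0 c cs].
- by rewrite mxE msupp0.
- by rewrite mxE => /msuppD_le; rewrite mem_cat => /orP[/uc|/vc].
- rewrite mxE -scalerAl => /msuppZ_le /msuppM_le /allpairsP[[m1 m2] /= [+ /uc -> ->]].
  by rewrite msuppX inE => /eqP ->.
- have [s us vE] := star_decomposition v.
  by exists s, (fun c => unslice c (slice c v)); split=> // c; apply: unslice_comp.
apply: val_inj; apply/matrixP => i j; rewrite (ord1 j) [RHS]mxE; apply/mpolyP => m.
rewrite mcoeff0.
have wE b : b != m -> (val (w b) i 0)@_m = 0.
  move=> ne; apply: memN_msupp_eq0; apply: contra ne => /wc ->; exact: eqxx.
have [<-|ne] := eqVneq c m; last exact: wE.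
(* At the exponent [c], the vanishing sum keeps only the contribution of [w c]. *)
have := congr1 (fun v : star F => (val v i 0)@_c) w0.
rewrite raddf_sum summxE raddf_sum (bigD1_seq c) //= big1 => [|b ne].
  by rewrite addr0 mxE mcoeff0.
by apply: memN_msupp_eq0; apply: contra ne => /wc ->.
Qed.

(** * Comparison of phi^* with phi in each degree *)

Section Maps.
Context (F G : mfree n) (phi : {linear fmod K F -> fmod K G}).
Hypothesis phi_graded : is_graded (@fmod_comp K n F) (@fmod_comp K n G) phi.

Lemma star_map_graded :
  is_graded (@star_comp K n e F) (@star_comp K n e G) (star_map e phi).
Proof.
move=> c u uc j m; rewrite /= mxE => /mem_msupp_sum[i _] /msuppZ_le; exact: uc.
Qed.

Lemma mcoef_eq0 j i : ~~ (shift j <= shift i)%MM -> mcoef phi j i = 0.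
Proof. by move=> nle; rewrite /mcoef (negPf nle). Qed.

(** With a_i, b_j the shifts of [F], [G], multiplication by x^(a_i - b_j) takes x^(mbar c - a_i) to
    x^(mbar c - b_j), so only the scalar of phi^* remains. *)
Lemma slice_star_map c (v : star F) : slice c (star_map e phi v) = phi (slice c v).
Proof.
apply/matrixP => j k; rewrite (ord1 k) (mcoefP phi_graded) !mxE.
rewrite raddf_sum scaler_suml; apply: eq_bigr => i _ /=.
(* Without divisibility the exponents do not match, but then the scalar of [phi] or the coefficient
   of [v] is 0. *)
rewrite mxE mcoeffZ; have [le|nle] := boolP (shift j <= shift i)%MM; last first.
  by rewrite mcoef_eq0 // mul0r !scale0r mul0r.
have [le'|nle] := boolP (shift i <= mbar c)%MM; last first.
  by rewrite star_coef_eq0 // mulr0 !scale0r mulr0.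
by rewrite -scalerAl -scalerAr scalerA -mpolyXD addmC submDB.
Qed.

Lemma star_map_unslice c (w : fmod K F) :
  star_map e phi (unslice c w) = unslice c (phi w).
Proof.
apply: val_inj; apply/matrixP => j k; rewrite (ord1 k); apply/mpolyP => m.
rewrite unslice_coef /= mxE raddf_sum /=.
under eq_bigr do rewrite mcoeffZ unslice_coef.
case: eqP => _; last by rewrite big1 // => i _; rewrite mulr0.
rewrite (mcoefP phi_graded) raddf_sum /=.
case: ifP => [jc|/negbT njc]; last first.
  (* By transitivity, [shift i <= mbar c] rules out [shift j <= shift i], so the scalar is 0. *)
  rewrite big1 // => i _; case: ifP => [ic|]; last by rewrite mulr0.
  rewrite mcoef_eq0 ?mul0r //; apply: contra njc => /mnm_lepP ji.
  by apply/mnm_lepP => l; apply: leq_trans (ji l) _; apply/mnm_lepP.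
apply: eq_bigr => i _; rewrite -scalerAl mcoeffZ.
have [ji|nji] := boolP (shift j <= shift i)%MM; last by rewrite mcoef_eq0 ?mul0r.
by rewrite mcoeffXM lepm_sub2r // submBB.
Qed.

Lemma limage_star_map (v : star G) :
  v \in limage (star_map e phi) <-> forall c, slice c v \in limage phi.
Proof.
split=> [/limageP[u <-] c|im].
  by apply/limageP; exists (slice c u); rewrite slice_star_map.
(* A preimage is chosen for each slice; the finitely many degrees of [v] are then unsliced and
   added. *)
have /choice[w wP] c : exists w, phi w = slice c v by apply/limageP.
have [s _ vE] := star_decomposition v.
apply/limageP; exists (\sum_(c <- s) unslice c (w c)).
rewrite [RHS]vE linear_sum; apply: eq_bigr => c _.
by rewrite star_map_unslice wP.
Qed.

End Maps.

(** * Acyclicity of F^* and comparison of presentations *)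

Lemma star_acyclic (F : nat -> mfree n)
    (phi : forall i, {linear fmod K (F i.+1) -> fmod K (F i)}) :
  (forall i, is_graded (@fmod_comp K n (F i.+1)) (@fmod_comp K n (F i)) (phi i)) ->
  acyclic phi -> acyclic (fun i => star_map e (phi i)).
Proof.
move=> gphi [cphi ephi]; split=> [i u|i].
  by apply: slice_inj => c; rewrite !slice_star_map // cphi slice0.
(* The slices of a cycle are cycles for [phi], hence boundaries by exactness there. *)
apply/homology_eq0 => u u0; apply/limage_star_map => // c.
have /homology_eq0 := ephi i; apply.
by rewrite -slice_star_map // u0 slice0.
Qed.

(** Expresses the image of phi^* through the augmentation to [M], which allows two presentations of
    [M] to be compared. *)
Lemma limage_star_presentation (M : lmodType {mpoly K[n]})
    (M_ : 'X_{1..n} -> M -> Prop) (F1 F0 : mfree n)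
    (phi : {linear fmod K F1 -> fmod K F0}) (eps : {linear fmod K F0 -> M}) :
  is_presentation M_ phi eps -> forall v : star F0,
  v \in limage (star_map e phi) <-> forall c, eps (slice c v) = 0.
Proof.
case=> gphi _ _ ex v; split=> [/limage_star_map im c|im].
  by apply/eqP; have := im gphi c; rewrite -ex.
by apply/limage_star_map => // c; rewrite -ex; apply/eqP.
Qed.

Lemma star_coker_iso (M : lmodType {mpoly K[n]}) (M_ : 'X_{1..n} -> M -> Prop)
    (F1 F0 : mfree n) (phi : {linear fmod K F1 -> fmod K F0})
    (eps : {linear fmod K F0 -> M})
    (G1 G0 : mfree n) (psi : {linear fmod K G1 -> fmod K G0})
    (eta : {linear fmod K G0 -> M}) :
  is_multigrading M_ -> is_presentation M_ phi eps -> is_presentation M_ psi eta ->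
  graded_isomorphic (star_coker_comp e phi) (star_coker_comp e psi).
Proof.
move=> M_graded pF pG; have [gphi geps seps _] := pF; have [gpsi geta seta _] := pG.
(* The two lifts need not be mutually inverse; they commute with the augmentations, and this
   determines them modulo the images. *)
have [al gal alE] := graded_lift M_graded geps geta seta.
have [be gbe beE] := graded_lift M_graded geta geps seps.
have imE (v : star F0) : (star_map e al v \in limage (star_map e psi)) =
    (v \in limage (star_map e phi)).
  apply/idP/idP => /limage_star_presentation im;
    apply/limage_star_presentation; try eassumption; move=> c.
    by rewrite -alE -slice_star_map //; apply: im pG c.
  by rewrite slice_star_map // alE; apply: im pF c.
have ab (w : star G0) : star_map e al (star_map e be w) - w \in limage (star_map e psi).
  apply/(limage_star_presentation pG) => c.
  by rewrite sliceB !slice_star_map // linearB /= alE beE subrr.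
have [h bh hE] := coker_iso imE ab.
exists h; split=> // c u; split=> [[v vc <-]|[w wc hu]].
  by exists (star_map e al v); rewrite ?hE //; apply: star_map_graded.
(* A homogeneous representative of [u] comes from applying be^* to the representative [w] of [h u];
   injectivity of [h] identifies the classes. *)
exists (star_map e be w); first exact: star_map_graded.
apply: (bij_inj bh); rewrite -hu hE; apply/quot_projP; exact: ab.
Qed.

End Slices.

(** * The star complex of a free resolution *)

Theorem theorem2p2 (K : fieldType) (n : nat) (e : 'I_n -> nat)
    (e_gt0 : forall j, (0 < e j)%N)
    (M : lmodType {mpoly K[n]}) (M_ : 'X_{1..n} -> M -> Prop)
    (M_graded : is_multigrading M_) (M_fg : finitely_generated M)
    (p : nat) (F : nat -> mfree n)
    (phi : forall i, {linear fmod K (F i.+1) -> fmod K (F i)})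
    (eps : {linear fmod K (F 0%N) -> M})
    (F_res : is_free_resolution M_ p phi eps)
    (G1 G0 : mfree n) (psi : {linear fmod K G1 -> fmod K G0})
    (eta : {linear fmod K G0 -> M})
    (G_pres : is_presentation M_ psi eta) :
  let Fs_ := fun i => @star_comp K n e (F i) in
  let phis := fun i => star_map e (phi i) in
  [/\ forall i, is_multigrading (Fs_ i),
      forall i, is_graded (Fs_ i.+1) (Fs_ i) (phis i),
      acyclic phis
    & graded_isomorphic (M := homology phis 0) (N := star_coker e psi)
        (coker_comp (phis 0%N) (Fs_ 0%N)) (star_coker_comp e psi)].
Proof.
have [_ gphi aphi F_pres] := F_res.
split=> [i|i||]; first exact: star_multigrading.
- exact: star_map_graded.
- exact: star_acyclic.
(* H_0 is by definition the cokernel of the first differential of F^*, so the end of the resolution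
   is compared with the presentation [psi]. *)
exact: star_coker_iso M_graded F_pres G_pres.
Qed.
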